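(* Let $\alpha>0$. The adjusted moments $\widetilde\mu_{i,j}=\int_0^\infty (x-r)^i(x-s)^j\,\widehat W(x)\,dx$ ($i,j\in\mathbb N_0$) of the Type I $X_2$ exceptional Laguerre weight are completely determined by the recursion-like formulas $$\widetilde\mu_{i+1,j}=\widetilde\mu_{i,j+1}+2\sqrt{\alpha+1}\,\widetilde\mu_{i,j}\qquad (i,j\in\mathbb N_0),$$ $$\begin{aligned}\widetilde\mu_{i+1,j+1}={}&\left[i+j-1+2\alpha+\sqrt{\alpha+1}\right]\widetilde\mu_{i+1,j}\\&+\left[(1-i-j)(\alpha+1)+(3-3i-j-4\alpha)\sqrt{\alpha+1}\right]\widetilde\mu_{i,j}\\&+\left[(2i-4)(\alpha+1)\left(\sqrt{\alpha+1}+1\right)\right]\widetilde\mu_{i-1,j}\qquad (i\in\mathbb N,\ j\in\mathbb N_0),\end{aligned}$$ together with the three initial values $$\widetilde\mu_{2,2}=4\,\Gamma(1+\alpha),$$ $$\widetilde\mu_{1,2}=4e^{-r}(-r)^{\alpha}\,\Gamma(1+\alpha)\,\Gamma(-\alpha,-r),$$ $$\widetilde\mu_{2,1}=4e^{-s}(-s)^{\alpha}\,\Gamma(1+\alpha)\,\Gamma(-\alpha,-s).$$ That is, the adjusted moments have these three values, and they are the only family of real numbers indexed by $\mathbb N_0\times\mathbb N_0$ that satisfies both recursion-like formulas and has these three values.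
   Context: $\mathbb N=\{1,2,\ldots\}$, $\mathbb N_0=\mathbb N\cup\{0\}$. $r=-(\alpha+1)-\sqrt{\alpha+1}$ and $s=-(\alpha+1)+\sqrt{\alpha+1}$ are the two roots (both negative) of $L_2^{\alpha-1}(-x)=\tfrac12x^2+(\alpha+1)x+\tfrac{\alpha(\alpha+1)}2=\tfrac12(x-r)(x-s)$, where $L_2^{\alpha-1}$ is the classical Laguerre polynomial of degree 2 with parameter $\alpha-1$. The Type I $X_2$ exceptional Laguerre weight is $$\widehat W(x)=\frac{x^{\alpha}e^{-x}}{\left(L_2^{\alpha-1}(-x)\right)^2}\qquad(0<x<\infty).$$ The Gamma function is $\Gamma(x)=\int_0^\infty t^{x-1}e^{-t}\,dt$ and the incomplete Gamma function is $\Gamma(x,a)=\int_a^\infty t^{x-1}e^{-t}\,dt$ for $a>0$ (and any real $x$). *)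

(* Defs.v *)
From HB Require Import structures.
From mathcomp Require Import all_boot all_order all_algebra.
From mathcomp Require Import all_classical all_reals all_analysis.
From mathcomp Require Import ring.
Set Implicit Arguments.
Unset Strict Implicit.
Unset Printing Implicit Defensive.
Import Order.TTheory GRing.Theory Num.Theory.
Import numFieldNormedType.Exports.
Local Open Scope classical_set_scope.
Local Open Scope ring_scope.

Section X2Laguerre.
Context {R : realType}.
Implicit Types (alpha x a z : R) (n m i j k : nat).

Definition Gamma x : R :=
  \int[@lebesgue_measure R]_(t in `]0, +oo[) (t `^ (x - 1) * expR (- t)).

Definition incGamma x a : R :=
  \int[@lebesgue_measure R]_(t in `]a, +oo[) (t `^ (x - 1) * expR (- t)).

Definition gbinom z m : R := (\prod_(l < m) (z - l%:R)) / (m`!)%:R.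

(* L_n^a(x) = \sum_(k <= n) (-1)^k binom(n + a, n - k) x^k / k! *)
Definition laguerre n a : {poly R} :=
  \poly_(k < n.+1) ((-1) ^+ k * gbinom (n%:R + a) (n - k) / (k`!)%:R).

Definition X2_r alpha : R := - (alpha + 1) - Num.sqrt (alpha + 1).
Definition X2_s alpha : R := - (alpha + 1) + Num.sqrt (alpha + 1).

Lemma laguerre2E alpha x :
  (laguerre 2 (alpha - 1)).[- x] =
  2^-1 * x ^+ 2 + (alpha + 1) * x + alpha * (alpha + 1) / 2.
Proof.
rewrite horner_poly !big_ord_recr big_ord0 /= subn0 subnn (_ : 2 - 1 = 1)%N //.
by rewrite /gbinom !big_ord_recr !big_ord0 /= !factS fact0 !muln1; field.
Qed.

Lemma laguerre2_factor alpha x : 0 <= alpha + 1 ->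
  (laguerre 2 (alpha - 1)).[- x] = 2^-1 * ((x - X2_r alpha) * (x - X2_s alpha)).
Proof.
move=> a1; have /= := sqr_sqrtr a1; rewrite laguerre2E /X2_r /X2_s.
set c := Num.sqrt _ => c2.
have -> : (x - (- (alpha + 1) - c)) * (x - (- (alpha + 1) + c)) =
  (x + (alpha + 1)) ^+ 2 - c ^+ 2 by ring.
by rewrite c2; field.
Qed.

Definition X2_weight alpha x : R :=
  x `^ alpha * expR (- x) / (laguerre 2 (alpha - 1)).[- x] ^+ 2.

Definition moment_integrand alpha i j x : R :=
  (x - X2_r alpha) ^+ i * (x - X2_s alpha) ^+ j * X2_weight alpha x.

Definition adjusted_moment alpha i j : R :=
  \int[@lebesgue_measure R]_(x in `]0, +oo[) moment_integrand alpha i j x.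

Definition moment_recursion1 alpha (mu : nat -> nat -> R) : Prop :=
  forall i j : nat,
    mu i.+1 j = mu i j.+1 + 2 * Num.sqrt (alpha + 1) * mu i j.

Definition moment_recursion2 alpha (mu : nat -> nat -> R) : Prop :=
  forall i j : nat, (0 < i)%N ->
    mu i.+1 j.+1 =
      (i%:R + j%:R - 1 + 2 * alpha + Num.sqrt (alpha + 1)) * mu i.+1 j
      + ((1 - i%:R - j%:R) * (alpha + 1)
         + (3 - 3 * i%:R - j%:R - 4 * alpha) * Num.sqrt (alpha + 1)) * mu i j
      + ((2 * i%:R - 4) * (alpha + 1) * (Num.sqrt (alpha + 1) + 1)) * mu i.-1 j.

Definition moment_initial alpha (mu : nat -> nat -> R) : Prop :=
  let r := X2_r alpha in let s := X2_s alpha in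
  [/\ mu 2 2 = 4 * Gamma (1 + alpha),
      mu 1 2 = 4 * expR (- r) * (- r) `^ alpha
               * Gamma (1 + alpha) * incGamma (- alpha) (- r)
    & mu 2 1 = 4 * expR (- s) * (- s) `^ alpha
               * Gamma (1 + alpha) * incGamma (- alpha) (- s)].

End X2Laguerre.

(* Main.v *)
Require Import Defs.
From HB Require Import structures.
From mathcomp Require Import all_boot all_order all_algebra.
From mathcomp Require Import all_classical all_reals all_analysis.
From mathcomp Require Import measurable_realfun ring lra.
Set Implicit Arguments.
Unset Strict Implicit.
Unset Printing Implicit Defensive.
Import Order.TTheory GRing.Theory Num.Theory.
Import numFieldNormedType.Exports.
Local Open Scope classical_set_scope.
Local Open Scope ring_scope.

(** Write c for the square root of alpha + 1, so that s - r = 2c, and let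
    m i j be the integrand of the (i, j) moment: for x >= 0,
    m i j x = 4 x^alpha e^(-x) (x - r)^(i-2) (x - s)^(j-2).

    Since r, s < 0 < alpha, each m i j is continuous on [0, +oo[ and is a
    function of subexponential growth times e^(-x), hence O(e^(-x/2))
    ([exp_decay_moment]).  This gives integrability, and it makes boundary
    terms at infinity vanish.

    The first recursion is x - r = (x - s) + 2c under the integral sign.  The
    second one is an integration by parts: for i >= 1 the function
    F = x * m i (j + 1) vanishes at 0 and at infinity, so the integral of F'
    is 0, and F' expands as a linear combination of m (i + 1) j, m i j,
    m (i - 1) j and m (i + 1) (j + 1) whose coefficients are those of the
    recursion ([is_derive_recursion2], [integral_derive_decay]).

    The value at (2, 2) is the definition of Gamma.  The other two are
    Stieltjes transforms of x^alpha e^(-x) at the points -r and -s.  For a > 0,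
    the kernel 1 / (x + a) is an integral of exponentials over t > a, namely
    e^(-x) / (x + a) = (e^a / a) * int_a^oo e^(-t (x / a + 1)) dt, and
    exchanging the two integrals turns the transform into a product of Gamma
    and incGamma ([stieltjes_Gamma]).

    For uniqueness, the recursions are linear and the difference d of two
    solutions has d 2 2 = d 1 2 = d 2 1 = 0.  The recursions around these
    entries give in turn d 1 1 = 0, d 0 1 = 0 and
    2 c^2 (c - 1) d 0 0 = 0; as alpha > 0 means c > 1, d 0 0 = 0.  The second
    recursion at j = 0, combined with the first, expresses an
    entry of the column d _ 0 by the three preceding ones, so that this column
    vanishes, and the first recursion spreads this to all columns
    ([moment_recursion_zero]). *)

(** * Functions of exponential decay on the half-line *)

Section ExponentialDecay.
Context {R : realType}.
Implicit Types (f F : R -> R) (a k C : R).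
Local Notation mu := (@lebesgue_measure R).

Lemma cvg_expR_decay k : 0 < k -> expR (- k * x) @[x --> +oo] --> (0 : R).
Proof.
move=> k0.
rewrite (_ : (fun x => expR (- k * x)) =
             (fun z => expR (- z)) \o (fun z => k * z)); last first.
  by apply: eq_fun => x; rewrite mulNr.
apply: (@cvg_comp _ _ _ _ _ _ (pinfty_nbhs R)); last exact: cvgr_expR.
exact: gt0_cvgMry.
Qed.

Lemma continuous_expRM k : continuous (fun x : R => expR (k * x)).
Proof.
by move=> x; apply: continuous_comp; [exact: mulrl_continuous|exact: continuous_expR].
Qed.

Lemma integral_expR_decay a k : 0 < k ->
  (\int[mu]_(x in `]a, +oo[) (expR (- k * x))%:E = (expR (- k * a) / k)%:E)%E.
Proof.
move=> k0; rewrite integral_itv_obnd_cbnd; last first.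
  apply/measurable_EFinP; apply: measurable_funTS.
  by apply: continuous_measurable_fun; exact: continuous_expRM.
rewrite (@ge0_continuous_FTC2y _ _ (fun x => - k^-1 * expR (- k * x)) _ 0).
- by rewrite sub0e -EFinN mulNr opprK mulrC.
- by move=> x _; exact: expR_ge0.
- by apply: continuous_subspaceT; exact: continuous_expRM.
- rewrite -(mulr0 (- k^-1)); apply: cvgMr; exact: cvg_expR_decay.
- by move=> x _; exact: ex_derive.
- apply: cvg_at_right_filter; apply: cvgMr; exact: continuous_expRM.
- move=> x _; rewrite derive1E derive_val.
  by rewrite /GRing.scale /=; field; rewrite gt_eqF.
Qed.

(** Continuity is one-sided at 0 because x^alpha jumps there: [powR] takes the
    value 1 at negative arguments. *)
Definition exp_decay k f :=
  {within `[0, +oo[, continuous f} /\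
  exists C, forall x : R, 0 <= x -> `|f x| <= C * expR (- k * x).

Lemma exp_decayZ k a f : exp_decay k f -> exp_decay k (fun x => a * f x).
Proof.
move=> [cf [C fC]]; split.
  by move=> x; apply: cvgMr; exact: cf.
exists (`|a| * C) => x x0; rewrite normrM -mulrA ler_wpM2l//; exact: fC.
Qed.

Lemma exp_decayD k f g : exp_decay k f -> exp_decay k g ->
  exp_decay k (fun x => f x + g x).
Proof.
move=> [cf [C fC]] [cg [D gD]]; split.
  by move=> x; apply: cvgD; [exact: cf|exact: cg].
exists (C + D) => x x0.
by rewrite mulrDl (le_trans (ler_normD _ _))// lerD// ?fC ?gD.
Qed.

Lemma exp_decay_expR k : exp_decay k (fun x => expR (- k * x)).
Proof.
split; first by apply: continuous_subspaceT; exact: continuous_expRM.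
by exists 1 => x _; rewrite mul1r ger0_norm ?expR_ge0.
Qed.

Lemma exp_decay_cvg0 k f : 0 < k -> exp_decay k f ->
  f x @[x --> +oo] --> (0 : R).
Proof.
move=> k0 [_ [C fC]]; apply/norm_cvg0P.
apply: (@squeeze_cvgr _ _ _ _ (cst 0) (fun x => C * expR (- k * x))).
- near=> x; rewrite normr_ge0 /= fC//.
- exact: cvg_cst.
- by rewrite -[X in _ --> X](mulr0 C); apply: cvgMr; exact: cvg_expR_decay.
Unshelve. all: by end_near. Qed.

Lemma exp_decay_integrable k f : 0 < k -> exp_decay k f ->
  mu.-integrable `]0, +oo[ (EFin \o f).
Proof.
move=> k0 [cf [C fC]].
have mf : measurable_fun `](0:R), +oo[ f.
  apply: open_continuous_measurable_fun => //.
  by move: cf => /continuous_within_itvcyP[/in_continuous_mksetP cf _].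
apply: (@le_integrable _ _ _ mu _ _ _ (EFin \o (fun x => C * expR (- k * x)))) => //.
- exact/measurable_EFinP.
- move=> x; rewrite /= in_itv/= andbT => /ltW x0.
  by rewrite lee_fin (le_trans (fC _ x0))// ler_norm.
- rewrite (_ : EFin \o _ = (fun x : R => C%:E * (expR (- k * x))%:E)%E) //.
  apply: integrableZl => //.
  apply/integrableP; split.
    apply/measurable_EFinP; apply: measurable_funTS.
    by apply: continuous_measurable_fun; exact: continuous_expRM.
  under eq_integral do rewrite /= ger0_norm ?expR_ge0//.
  by rewrite integral_expR_decay// ltry.
Qed.

(** To reduce to a nonnegative integrand, where the integrals over [0, n]
    increase to the one over [0, +oo[, add C e^(-kx) to f, with C the decay
    constant of f; this changes both sides by C / k. *)
Lemma integral_derive_decay k f F : 0 < k -> exp_decay k f -> exp_decay k F ->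
  (forall x : R, 0 < x -> is_derive x 1 F (f x)) ->
  \int[mu]_(x in `]0, +oo[) f x = - F 0.
Proof.
move=> k0 df dF F'f.
have Foo := exp_decay_cvg0 k0 dF.
have If := exp_decay_integrable k0 df.
move: (df) (dF) => [/continuous_within_itvcyP[cf cf0] [C fC]].
move=> [/continuous_within_itvcyP[_ F0] _].
have iE : mu.-integrable `]0, +oo[ (EFin \o (fun x : R => C * expR (- k * x))).
  exact: exp_decay_integrable (exp_decayZ C (exp_decay_expR k)).
have IE : \int[mu]_(x in `]0, +oo[) (C * expR (- k * x)) = C / k.
  rewrite RintegralZl//; last exact: exp_decay_integrable (exp_decay_expR k).
  by rewrite /Rintegral integral_expR_decay//= mulr0 expR0 mul1r.
apply: (addIr (C / k)); rewrite -{1}IE -RintegralD//.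
rewrite Rintegral_itv_obnd_cbnd; last exact: (@integrableD _ _ _ mu _ _ _ _ If iE).
rewrite (@Rintegral_ge0_continuous_FTC2y _ _
  (fun x => F x - C / k * expR (- k * x)) _ 0).
- by rewrite mulr0 expR0 mulr1 sub0r opprB addrC.
- by move=> x x0; have := fC x x0; rewrite ler_norml; lra.
- apply/continuous_within_itvcyP; split.
    move=> x x0; apply: cvgD; first exact: cf.
    by apply: cvgMr; exact: continuous_expRM.
  apply: cvgD => //; apply: cvg_at_right_filter.
  by apply: cvgMr; exact: continuous_expRM.
- rewrite -(subr0 0); apply: cvgB => //.
  rewrite -(mulr0 (C / k)); apply: cvgMr; exact: cvg_expR_decay.
- by move=> x x0; have := F'f x x0 => ?; exact: ex_derive.
- apply: cvgB => //; apply: cvg_at_right_filter.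
  by apply: cvgMr; exact: continuous_expRM.
- move=> x; rewrite in_itv/= andbT => x0; have := F'f x x0 => ?.
  rewrite derive1E derive_val.
  by rewrite /GRing.scale /=; field; rewrite gt_eqF.
Qed.

End ExponentialDecay.

(** * The Stieltjes transform of the Gamma density *)

Section StieltjesTransform.
Context {R : realType}.
Implicit Types (a k alpha : R).
Local Notation mu := (@lebesgue_measure R).

(** Reduces to the theorem on the whole plane by extending g by 0 outside the
    rectangle. *)
Lemma tonelli_rectangle (D E : set R) (g : R * R -> \bar R) :
  measurable D -> measurable E ->
  measurable_fun (D `*` E) g ->
  (forall x y, D x -> E y -> 0 <= g (x, y))%E ->
  (\int[mu]_(x in D) \int[mu]_(y in E) g (x, y) =
   \int[mu]_(y in E) \int[mu]_(x in D) g (x, y))%E.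
Proof.
move=> mD mE mg g0.
pose h := g \_ (D `*` E).
have mh : measurable_fun [set: R * R] h.
  by apply/(measurable_restrictT _ _).1 => //; exact: measurableX.
have h0 z : (0 <= h z)%E.
  by apply: erestrict_ge0 => -[x y] /= [Dx Ey]; exact: g0.
have hE x y : h (x, y) = if (x \in D) && (y \in E) then g (x, y) else 0%E.
  by rewrite /h patchE in_setX.
transitivity (\int[mu]_x \int[mu]_y h (x, y))%E.
  rewrite integral_mkcond; apply: eq_integral => x _; rewrite patchE.
  case: ifPn => xD; last first.
    by rewrite integral0_eq // => y _; rewrite hE (negbTE xD).
  rewrite integral_mkcond; apply: eq_integral => y _.
  by rewrite hE patchE xD.
transitivity (\int[mu]_y \int[mu]_x h (x, y))%E.
  exact: (@fubini_tonelli _ _ _ _ _ mu mu h mh h0).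
rewrite [RHS]integral_mkcond; apply: eq_integral => y _; rewrite patchE.
case: ifPn => yE; last first.
  by rewrite integral0_eq // => x _; rewrite hE (negbTE yE) andbF.
rewrite [RHS]integral_mkcond; apply: eq_integral => x _.
by rewrite hE patchE yE andbT.
Qed.

Lemma continuous_powRM alpha (h : R -> R) : 0 < alpha ->
  (forall x, 0 <= x -> {for x, continuous h}) ->
  {within `[0, +oo[, continuous (fun x => x `^ alpha * h x)}.
Proof.
move=> a0 ch; apply/continuous_within_itvcyP; split.
  move=> x; rewrite in_itv/= andbT => x0; apply: cvgM; last first.
    by apply: ch; exact: ltW.
  have : {for x, continuous (@powR R ^~ alpha)}.
    apply/differentiable_continuous; rewrite -derivable1_diffP.
    by apply: derivable_powR; rewrite in_itv/= x0.
  exact.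
rewrite powR0 ?gt_eqF// mul0r -[X in _ --> X](mul0r (h 0)).
apply: cvgM; first exact: powR_cvg0.
by apply: cvg_at_right_filter; exact: ch.
Qed.

(** The substitution y = k x in the Gamma integral. *)
Lemma integral_powR_expR_scaling alpha k : 0 < alpha -> 0 < k ->
  (\int[mu]_(x in `]0%R, +oo[) (x `^ alpha * expR (- (k * x)))%:E =
   (k `^ (- (1 + alpha)))%:E *
     \int[mu]_(x in `]0%R, +oo[) (x `^ alpha * expR (- x))%:E)%E.
Proof.
move=> a0 k0.
pose G (x : R) := x `^ alpha * expR (- x).
have mG : measurable_fun [set: R] G.
  apply: measurable_funM => //; apply: continuous_measurable_fun => x.
  by apply: continuous_comp; [exact: opp_continuous|exact: continuous_expR].
have mGk : measurable_fun `](0:R), +oo[ (fun x => (G (k * x) * k)%:E).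
  apply/measurable_EFinP; apply: measurable_funTS; apply: measurable_funM => //.
  exact: (measurableT_comp mG (mulrl_measurable k)).
have dk x : is_derive x (1:R) (fun x : R => k * x) k.
  by apply: is_derive_eq; rewrite /GRing.scale/= mulr1.
have dkE : (fun x : R => k * x)^`()%classic = cst k.
  by apply/funext => x; rewrite derive1E derive_val.
rewrite -[X in (_ * X)%E]/(\int[mu]_(x in `]0%R, +oo[) (G x)%:E)%E.
rewrite [X in (_ * X)%E]integral_itv_obnd_cbnd; last first.
  by apply/measurable_EFinP; exact: measurable_funTS.
(* Put the lower bound in the form F 0 for the substitution F x = k * x. *)
transitivity ((k `^ (- (1 + alpha)))%:E * \int[mu]_(x in `[(k * 0)%R, +oo[) (G x)%:E)%E;
  last by rewrite mulr0.
rewrite (@increasing_ge0_integration_by_substitutiony _ (fun x => k * x)) //.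
- rewrite dkE -integral_itv_obnd_cbnd// -ge0_integralZl_EFin//=; last 2 first.
  + by move=> x _; rewrite lee_fin !mulr_ge0 ?powR_ge0 ?expR_ge0 ?invr_ge0 ?ltW.
  + exact: powR_ge0.
  apply: eq_integral => x; rewrite inE/= in_itv/= andbT => x0.
  rewrite -EFinM /G /=; congr EFin.
  rewrite -[RHS]/(_ * (((k * x) `^ alpha * expR (- (k * x))) * k)) powRM ?ltW//.
  rewrite powRN addrC powRD ?(gt_eqF k0) ?implybT// powRr1 ?ltW//.
  by field; rewrite !gt_eqF ?powR_gt0.
- by move=> x y _ _ xy; rewrite ltr_pM2l.
- by move=> x _; rewrite dkE; exact: cst_continuous.
- by rewrite dkE; exact: is_cvg_cst.
- by rewrite dkE; exact: is_cvg_cst.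
- split; first by move=> x _; exact: ex_derive.
  by apply: cvg_at_right_filter; exact: mulrl_continuous.
- exact: gt0_cvgMry.
- rewrite mulr0; apply: continuous_powRM => // x _.
  by apply: continuous_comp; [exact: opp_continuous|exact: continuous_expR].
- by move=> x _; rewrite mulr_ge0 ?powR_ge0 ?expR_ge0.
Qed.

(** Both iterated integrals of
    g (x, t) = (e^a / a) x^alpha e^(-t (x / a + 1)) over x > 0, t > a can be
    computed: integrating in t first gives the integrand on the left, and
    integrating in x first gives, by scaling with k = t / a, a constant
    multiple of the integrand t^(-alpha-1) e^(-t) of incGamma. *)
Lemma stieltjes_Gamma alpha a : 0 < alpha -> 0 < a ->
  mu.-integrable `]0, +oo[ (EFin \o (fun x : R => x `^ alpha * expR (- x))) ->
  \int[mu]_(x in `]0, +oo[) (x `^ alpha * expR (- x) / (x + a)) =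
  a `^ alpha * expR a * Gamma (1 + alpha) * incGamma (- alpha) a.
Proof.
move=> al0 a0 intG.
pose c := expR a / a.
have c0 : 0 < c by rewrite divr_gt0 ?expR_gt0.
pose g (z : R * R) : \bar R := (c * z.1 `^ alpha * expR (- (z.1 / a + 1) * z.2))%:E.
have mg : measurable_fun (`](0:R), +oo[ `*` `]a, +oo[) g.
  apply: measurable_funTS; apply/measurable_EFinP; apply: measurable_funM.
    apply: measurable_funM => //.
    exact: (measurableT_comp (measurable_powR alpha) measurable_fst).
  apply: measurableT_comp => //; apply: measurable_funM => //.
  apply: measurableT_comp => //.
  by apply: measurable_funD => //; apply: measurable_funM.
have g0 x t : (0 <= g (x, t))%E.
  by rewrite lee_fin !mulr_ge0 ?powR_ge0 ?expR_ge0 ?invr_ge0 ?ltW.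
have EG : (\int[mu]_(x in `]0%R, +oo[) (x `^ alpha * expR (- x))%:E =
    (Gamma (1 + alpha))%:E)%E.
  rewrite /Gamma (_ : 1 + alpha - 1 = alpha); last by ring.
  by rewrite /Rintegral fineK //; exact: integrable_fin_num.
have inner_t x : 0 < x -> (\int[mu]_(t in `]a, +oo[) g (x, t) =
    (x `^ alpha * expR (- x) / (x + a))%:E)%E.
  move=> x0; rewrite /g/=.
  have k0 : 0 < x / a + 1 by rewrite addr_gt0 ?divr_gt0.
  under eq_integral do rewrite EFinM.
  rewrite ge0_integralZl_EFin//=; last 2 first.
  - apply/measurable_EFinP; apply: measurable_funTS.
    by apply: continuous_measurable_fun; exact: continuous_expRM.
  - by rewrite !mulr_ge0 ?powR_ge0 ?expR_ge0 ?invr_ge0 ?ltW.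
  rewrite integral_expR_decay// -EFinM; congr EFin.
  rewrite (_ : - (x / a + 1) * a = - x - a); last by field; rewrite gt_eqF.
  by rewrite expRD (expRN a) /c; field; rewrite !gt_eqF ?addr_gt0 ?expR_gt0.
have inner_x t : a < t -> (\int[mu]_(x in `]0%R, +oo[) g (x, t) =
    (c * a `^ (1 + alpha) * Gamma (1 + alpha))%:E *
      (t `^ (- alpha - 1) * expR (- t))%:E)%E.
  move=> at0; have t0 : 0 < t by rewrite (lt_trans a0).
  transitivity (\int[mu]_(x in `]0%R, +oo[)
    ((c * expR (- t))%:E * (x `^ alpha * expR (- (t / a * x)))%:E))%E.
    apply: eq_integral => x _; rewrite /g/= -EFinM; congr EFin.
    rewrite (_ : - (x / a + 1) * t = - t + - (t / a * x)); last by field; rewrite gt_eqF.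
    by rewrite expRD; ring.
  rewrite ge0_integralZl_EFin//=; last 3 first.
  - by move=> x _; rewrite lee_fin mulr_ge0 ?powR_ge0 ?expR_ge0.
  - apply/measurable_EFinP; apply: measurable_funTS; apply: measurable_funM => //.
    apply: continuous_measurable_fun => x.
    apply: continuous_comp; last exact: continuous_expR.
    by apply: cvgN; exact: mulrl_continuous.
  - by rewrite mulr_ge0 ?expR_ge0 ?ltW.
  rewrite integral_powR_expR_scaling ?divr_gt0// EG -!EFinM; congr EFin.
  rewrite powRM ?invr_ge0 ?ltW// (_ : - alpha - 1 = - (1 + alpha)); last by ring.
  have -> : a^-1 `^ (- (1 + alpha)) = a `^ (1 + alpha).
    by rewrite -powR_inv1 ?ltW// -powRrM mulN1r opprK.
  by ring.
have := tonelli_rectangle (measurable_itv `](0:R), +oo[)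
  (measurable_itv `]a, +oo[) mg (fun x t _ _ => g0 x t).
under eq_integral => x; first rewrite inE/= in_itv/= andbT => x0;
  first rewrite inner_t//.
  over.
under [X in _ = X]eq_integral => t; first rewrite inE/= in_itv/= andbT => at0;
  first rewrite inner_x//.
  over.
have G0 : 0 <= Gamma (1 + alpha).
  by apply: Rintegral_ge0 => x _; rewrite mulr_ge0 ?powR_ge0 ?expR_ge0.
rewrite ge0_integralZl_EFin//=; last 3 first.
- by move=> x _; rewrite lee_fin mulr_ge0 ?powR_ge0 ?expR_ge0.
- apply/measurable_EFinP; apply: measurable_funTS; apply: measurable_funM => //.
  by apply: measurableT_comp.
- exact: mulr_ge0 (mulr_ge0 (ltW c0) (powR_ge0 _ _)) G0.
move=> /(congr1 fine); rewrite -/(Rintegral _ _ _) => ->.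
have cE : c * a `^ (1 + alpha) = a `^ alpha * expR a.
  by rewrite addrC powRD ?(gt_eqF a0) ?implybT// powRr1 ?ltW// /c; field; rewrite gt_eqF.
rewrite cE /incGamma /Rintegral.
(* The constant factors out of [fine] even from an infinite integral. *)
move: (a `^ alpha * _ * _) (\int[mu]_(x in _) _)%E => K.
have [->|K0] := eqVneq K 0; first by move=> X; rewrite mul0e mul0r.
by case=> [r| |] //=; rewrite mulr0 mulr_infty; case: sgrP K0 => //= _ _;
  rewrite ?mulN1e ?mul1e.
Qed.

End StieltjesTransform.

(** * Subexponential growth *)

Section Subexponential.
Context {R : realType}.
Implicit Types (f g : R -> R) (alpha b e C : R).

(** Quantifying over all rates e makes the class stable under products: each
    factor is bounded at the rate e / 2. *)
Definition subexponential f :=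
  forall e, 0 < e -> exists C, forall x : R, 0 <= x -> `|f x| <= C * expR (e * x).

Lemma subexponential_bounded f C :
  (forall x : R, 0 <= x -> `|f x| <= C) -> subexponential f.
Proof.
move=> fC e e0; exists `|C| => x x0; rewrite (le_trans (fC x x0))//.
rewrite (le_trans (ler_norm C))// ler_peMr// -expR0 ler_expR.
by rewrite mulr_ge0// ltW.
Qed.

Lemma subexponentialM f g : subexponential f -> subexponential g ->
  subexponential (fun x => f x * g x).
Proof.
move=> sf sg e e0; have e20 : 0 < e / 2 by rewrite divr_gt0.
have [C fC] := sf _ e20; have [D gD] := sg _ e20.
exists (C * D) => x x0; rewrite normrM.
rewrite (_ : C * D * _ = (C * expR (e / 2 * x)) * (D * expR (e / 2 * x))).
  by rewrite ler_pM ?fC ?gD.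
by rewrite (_ : e * x = e / 2 * x + e / 2 * x); [rewrite expRD; ring|field].
Qed.

Lemma subexponentialX f n : subexponential f -> subexponential (fun x => f x ^+ n).
Proof.
move=> sf; elim: n => [|n IH].
  by apply: (@subexponential_bounded _ 1) => x _; rewrite expr0 normr1.
under eq_fun do rewrite exprS; exact: subexponentialM.
Qed.

Lemma subexponential_translate b : subexponential (fun x => x - b).
Proof.
move=> e e0; exists (e^-1 + `|b|) => x x0.
have ex0 : 0 <= e * x by rewrite mulr_ge0// ltW.
rewrite (le_trans (ler_normB _ _))// mulrDl lerD//.
  rewrite ger0_norm// -ler_pdivrMl ?invr_gt0// invrK.
  by rewrite (le_trans _ (expR_ge1Dx _))// lerDr.
by rewrite ler_peMr// -expR0 ler_expR.
Qed.

(** Raise the bound x <= (alpha / e) e^(e x / alpha) to the power alpha. *)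
Lemma subexponential_powR alpha : 0 < alpha ->
  subexponential (fun x => x `^ alpha).
Proof.
move=> a0 e e0; have ea0 : 0 < e / alpha by rewrite divr_gt0.
exists ((alpha / e) `^ alpha) => x x0.
rewrite ger0_norm ?powR_ge0//.
rewrite (_ : expR (e * x) = expR (e / alpha * x) `^ alpha); last first.
  by rewrite -expRM; congr expR; field; rewrite gt_eqF.
have ae0 : 0 <= alpha / e by rewrite ltW// divr_gt0.
rewrite -powRM ?expR_ge0//.
apply: ge0_ler_powR; first exact: ltW.
- by rewrite nnegrE.
- by rewrite nnegrE; exact: mulr_ge0 ae0 (expR_ge0 _).
rewrite -ler_pdivrMl ?divr_gt0// invf_div.
by rewrite (le_trans _ (expR_ge1Dx _))// lerDr.
Qed.

End Subexponential.

(** * The moment integrands *)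

Section Moments.
Context {R : realType}.
Variable alpha : R.
Hypothesis alpha_gt0 : 0 < alpha.
Local Notation mu := (@lebesgue_measure R).
Local Notation c := (Num.sqrt (alpha + 1)).
Local Notation r := (X2_r alpha).
Local Notation s := (X2_s alpha).
Local Notation m := (moment_integrand alpha).

Lemma X2_alphaE : alpha = c ^+ 2 - 1.
Proof. by rewrite sqr_sqrtr ?addrK// addr_ge0 ?ltW. Qed.

Lemma sqrt_alpha1_gt1 : 1 < c.
Proof. by rewrite -{1}sqrtr1 ltr_sqrt ?addr_gt0// ltrDr. Qed.

Lemma X2_rE : r = - (c * (c + 1)).
Proof. by rewrite /X2_r {1}X2_alphaE; ring. Qed.

Lemma X2_sE : s = - (c * (c - 1)).
Proof. by rewrite /X2_s {1}X2_alphaE; ring. Qed.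

Lemma X2_r_lt0 : r < 0.
Proof.
by rewrite X2_rE oppr_lt0; have := sqrt_alpha1_gt1 => ?; rewrite mulr_gt0; lra.
Qed.

Lemma X2_s_lt0 : s < 0.
Proof.
by rewrite X2_sE oppr_lt0; have := sqrt_alpha1_gt1 => ?; rewrite mulr_gt0; lra.
Qed.

Lemma moment_integrandE i j x : m i j x =
  4 * (x `^ alpha * expR (- x)) *
    ((x - r) ^+ i * (x - s) ^+ j / ((x - r) * (x - s)) ^+ 2).
Proof.
rewrite /moment_integrand /X2_weight laguerre2_factor ?addr_ge0 ?ltW//.
by rewrite [in LHS]exprMn exprVn invfM invrK; ring.
Qed.

(** The factors other than e^(-x) grow subexponentially: r, s < 0 keeps the
    denominator above its value at 0.  Half of the decay of e^(-x) absorbs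
    them. *)
Lemma exp_decay_moment i j : exp_decay (1 / 2) (m i j).
Proof.
have r0 := X2_r_lt0; have s0 := X2_s_lt0.
pose w x : R := ((x - r) * (x - s)) ^+ 2.
have w0 x : 0 <= x -> 0 < w x.
  by move=> x0; rewrite exprn_gt0// mulr_gt0; lra.
pose h x := 4 * ((x - r) ^+ i * (x - s) ^+ j / w x) * expR (- x).
have mE : m i j = (fun x => x `^ alpha * h x).
  by apply/funext => x; rewrite moment_integrandE /h; ring.
split.
  rewrite mE; apply: continuous_powRM => // x x0.
  have cb b n : {for x, continuous (fun x : R => (x - b) ^+ n)}.
    apply: (@continuous_comp _ _ _ (fun x => x - b) (fun y => y ^+ n)).
      by apply: cvgB; [exact: cvg_id|exact: cvg_cst].
    exact: exprn_continuous.
  apply: cvgM; last first.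
    by apply: continuous_comp; [exact: opp_continuous|exact: continuous_expR].
  apply: cvgMr; apply: cvgM; first by apply: cvgM; exact: cb.
  apply: cvgV; first by rewrite gt_eqF// w0.
  rewrite (_ : w = fun x => (x - r) ^+ 2 * (x - s) ^+ 2).
    by apply: cvgM; exact: cb.
  by apply/funext => y; rewrite /w exprMn.
have sb : subexponential (fun x => 4 * (w x)^-1).
  apply: (@subexponential_bounded _ _ (4 / w 0)) => x x0.
  rewrite ger0_norm; last by rewrite mulr_ge0// invr_ge0 ltW// w0.
  rewrite ler_wpM2l//.
  rewrite lef_pV2 ?posrE ?w0// /w !exprMn.
  by rewrite ler_pM ?sqr_ge0// ler_sqr ?nnegrE; lra.
have : subexponential (fun x =>
    x `^ alpha * ((x - r) ^+ i * ((x - s) ^+ j * (4 * (w x)^-1)))).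
  apply: subexponentialM; first exact: subexponential_powR.
  apply: subexponentialM; first by apply/subexponentialX/subexponential_translate.
  by apply: subexponentialM => //; apply/subexponentialX/subexponential_translate.
move=> /(_ (1 / 2)) []; first by rewrite divr_gt0.
move=> C hC; exists C => x x0.
rewrite mE (_ : - (1 / 2) * x = 1 / 2 * x + - x); last by field.
rewrite expRD mulrA.
rewrite (_ : _ * h x = x `^ alpha * ((x - r) ^+ i * ((x - s) ^+ j * (4 * (w x)^-1)))
   * expR (- x)); last by rewrite /h; ring.
by rewrite normrM (ger0_norm (expR_ge0 _)) ler_wpM2r ?expR_ge0 ?hC.
Qed.

Lemma moment_integrable i j : mu.-integrable `]0, +oo[ (EFin \o m i j).
Proof. by apply: (@exp_decay_integrable _ (1 / 2)) => //; exact: exp_decay_moment. Qed.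

Lemma adjusted_moment_recursion1 : moment_recursion1 alpha (adjusted_moment alpha).
Proof.
move=> i j; rewrite /adjusted_moment -RintegralZl//; last exact: moment_integrable.
rewrite -RintegralD//; last 2 first.
- exact: moment_integrable.
- exact: integrableZl (moment_integrable i j).
by apply: eq_Rintegral => x _; rewrite /moment_integrand X2_rE X2_sE !exprS; ring.
Qed.

End Moments.

(** * The recursions and the initial values *)

Section Recursion.
Context {R : realType}.
Variable alpha : R.
Hypothesis alpha_gt0 : 0 < alpha.
Local Notation mu := (@lebesgue_measure R).
Local Notation c := (Num.sqrt (alpha + 1)).
Local Notation r := (X2_r alpha).
Local Notation s := (X2_s alpha).
Local Notation m := (moment_integrand alpha).

(** Right-hand side minus left-hand side of the second recursion, for the
    integrands and at the indices (i + 1, j). *)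
Definition recursion2_defect i j x : R :=
  ((i.+1%:R + j%:R - 1 + 2 * alpha + c) * m i.+2 j x +
  ((1 - i.+1%:R - j%:R) * (alpha + 1)
         + (3 - 3 * i.+1%:R - j%:R - 4 * alpha) * c) * m i.+1 j x) +
  (((2 * i.+1%:R - 4) * (alpha + 1) * (c + 1)) * m i j x +
   -1 * m i.+2 j.+1 x).

(** The primitive is x * m i.+1 j.+1 x, written with x = (x - r) + r as a
    combination of integrands, whose continuity and decay are known. *)
Lemma is_derive_recursion2 i j (x : R) : 0 < x ->
  is_derive x 1 (fun x => m i.+2 j.+1 x + r * m i.+1 j.+1 x)
    (recursion2_defect i j x).
Proof.
move=> x0; have r0 := X2_r_lt0 alpha_gt0; have s0 := X2_s_lt0 alpha_gt0.
rewrite (_ : (fun x => _) = (fun x => 4 * (x * x `^ alpha * expR (- x)) *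
  ((x - r) ^+ i.+1 * (x - s) ^+ j.+1 * ((x - r) * (x - s)) ^- 2))); last first.
  by apply/funext => y; rewrite !moment_integrandE// exprS; ring.
have dX := is_derive1_powR alpha x0.
have w0 : ((x - r) * (x - s)) ^+ 2 != 0.
  by rewrite gt_eqF// exprn_gt0// mulr_gt0; lra.
have dshift b : is_derive x 1 (fun y : R => y - b) 1.
  by apply: is_derive_eq; rewrite subr0.
have dpow b n : is_derive x 1 (fun y : R => (y - b) ^+ n.+1) (n.+1%:R * (x - b) ^+ n).
  rewrite (_ : (fun y => _) = (fun y : R => y - b) ^+ n.+1); last by rewrite exprfctE.
  apply: is_derive_eq.
  by rewrite /GRing.scale /= mulr1.
have dw : is_derive x 1 (fun y : R => ((y - r) * (y - s)) ^+ 2)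
    (2 * ((x - r) * (x - s)) * ((x - r) + (x - s))).
  rewrite (_ : (fun y => _) = ((fun y : R => y - r) * (fun y : R => y - s)) ^+ 2);
    last by rewrite exprfctE.
  apply: is_derive_eq.
  by rewrite /GRing.scale /= fctE; ring.
have dg : is_derive x 1 (fun y : R => 4 * (y * y `^ alpha * expR (- y)))
    (4 * ((alpha + 1 - x) * x `^ alpha * expR (- x))).
  have xE : x `^ (alpha - 1) = x `^ alpha / x.
    by rewrite powRB ?(gt_eqF x0) ?implybT// powRr1// ltW.
  by apply: is_derive_eq; rewrite /GRing.scale /= xE; field; rewrite gt_eqF.
have dV := @is_deriveV R (fun y => (((y - r) * (y - s)) ^+ 2 : R)) _ _ _ w0 dw.
apply: (is_derive_eq (is_deriveM dg (is_deriveM (is_deriveM (dpow r i) (dpow s j)) dV))).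
rewrite /GRing.scale /=.
rewrite /recursion2_defect !moment_integrandE// !fctE.
have u0 : x - r != 0 by rewrite gt_eqF//; lra.
have v0 : x - s != 0 by rewrite gt_eqF//; lra.
rewrite X2_rE// in u0 *; rewrite X2_sE// in v0 *.
rewrite !(exprS _ i.+1) !(exprS _ i) !(exprS _ j).
(* With alpha = c^2 - 1, r = - c (c + 1) and s = - c (c - 1) the goal is an
   identity between rational functions of x and c. *)
move: (_ ^+ i) (_ ^+ j) (x `^ alpha) (expR (- x)) (X2_alphaE alpha_gt0) u0 v0.
move: c => c' U V X E -> u0 v0.
by field; rewrite u0 v0.
Qed.

Lemma adjusted_moment_recursion2 : moment_recursion2 alpha (adjusted_moment alpha).
Proof.
move=> [//|i] j _; rewrite /= /adjusted_moment.
have Z a i' j' : exp_decay (1 / 2) (fun x => a * m i' j' x).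
  by apply: exp_decayZ; exact: exp_decay_moment.
have half_gt0 : 0 < 1 / 2 :> R by rewrite divr_gt0.
have DE : \int[mu]_(x in `]0, +oo[) recursion2_defect i j x = 0.
  have dP : exp_decay (1 / 2) (fun x => m i.+2 j.+1 x + r * m i.+1 j.+1 x).
    by apply: exp_decayD => //; exact: exp_decay_moment.
  have dD : exp_decay (1 / 2) (recursion2_defect i j).
    by apply: exp_decayD; apply: exp_decayD.
  rewrite (integral_derive_decay half_gt0 dD dP (@is_derive_recursion2 i j)).
  by rewrite !moment_integrandE// powR0 ?gt_eqF//; ring.
move: DE; rewrite /recursion2_defect.
have I a i' j' : mu.-integrable `]0, +oo[ (EFin \o (fun x => a * m i' j' x)).
  exact: exp_decay_integrable (Z a i' j').
rewrite RintegralD//; last 2 first.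
- by apply: exp_decay_integrable half_gt0 _; exact: exp_decayD.
- by apply: exp_decay_integrable half_gt0 _; exact: exp_decayD.
rewrite !RintegralD// !RintegralZl//; try exact: moment_integrable.
by rewrite mulN1r => /eqP; rewrite !addrA subr_eq0 => /eqP <-.
Qed.

Lemma moment_integrand22 x : 0 <= x -> m 2 2 x = 4 * (x `^ alpha * expR (- x)).
Proof.
move=> x0; have := X2_r_lt0 alpha_gt0; have := X2_s_lt0 alpha_gt0 => s0 r0.
rewrite moment_integrandE// -exprMn divff ?mulr1// expf_neq0//.
by rewrite mulf_neq0 ?gt_eqF//; lra.
Qed.

Lemma integrable_Gamma :
  mu.-integrable `]0, +oo[ (EFin \o (fun x : R => x `^ alpha * expR (- x))).
Proof.
have : mu.-integrable `]0, +oo[ (EFin \o (fun x => 4^-1 * m 2 2 x)).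
  apply: (@exp_decay_integrable _ (1 / 2)); first by rewrite divr_gt0.
  by apply: exp_decayZ; exact: exp_decay_moment.
apply: eq_integrable => // x; rewrite inE/= in_itv/= andbT => /ltW x0.
by rewrite moment_integrand22// mulKf.
Qed.

Lemma adjusted_moment_initial : moment_initial alpha (adjusted_moment alpha).
Proof.
have r0 := X2_r_lt0 alpha_gt0; have s0 := X2_s_lt0 alpha_gt0.
have iG := integrable_Gamma.
have mI (b : R) i j : b < 0 ->
    (forall x : R, 0 < x -> m i j x = 4 * (x `^ alpha * expR (- x) / (x + - b))) ->
    adjusted_moment alpha i j = 4 * expR (- b) * (- b) `^ alpha
      * Gamma (1 + alpha) * incGamma (- alpha) (- b).
  move=> b0 mE; have I := moment_integrable alpha_gt0 i j.
  suff : 4^-1 * adjusted_moment alpha i j = expR (- b) * (- b) `^ alpha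
      * Gamma (1 + alpha) * incGamma (- alpha) (- b).
    by move=> /(congr1 ( *%R 4)); rewrite mulVKf// => ->; rewrite !mulrA.
  rewrite /adjusted_moment -RintegralZl// [expR _ * _]mulrC -stieltjes_Gamma ?oppr_gt0//.
  apply: eq_Rintegral => x; rewrite inE/= in_itv/= andbT => x0.
  by rewrite mE// mulKf.
have nz (b x : R) : b < 0 -> 0 < x -> x - b != 0 by move=> b0 x0; rewrite gt_eqF//; lra.
split.
- rewrite /adjusted_moment /Gamma (_ : 1 + alpha - 1 = alpha); last by ring.
  rewrite -RintegralZl//.
  apply: eq_Rintegral => x; rewrite inE/= in_itv/= andbT => /ltW x0.
  exact: moment_integrand22.
- by apply: mI => // x x0; rewrite moment_integrandE//; field; rewrite !nz.
- by apply: mI => // x x0; rewrite moment_integrandE//; field; rewrite !nz.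
Qed.

End Recursion.

(** * Uniqueness *)

Section Uniqueness.
Context {R : realType}.
Variable alpha : R.
Hypothesis alpha_gt0 : 0 < alpha.
Local Notation c := (Num.sqrt (alpha + 1)).

(** The positivity of alpha enters through c > 1: for c = 1 the three initial
    values would leave d 0 0 undetermined. *)
Lemma moment_recursion_zero (d : nat -> nat -> R) :
  moment_recursion1 alpha d -> moment_recursion2 alpha d ->
  d 2%N 2%N = 0 -> d 1%N 2%N = 0 -> d 2%N 1%N = 0 -> forall i j, d i j = 0.
Proof.
move=> rec1 rec2 d22 d12 d21.
have c1 := sqrt_alpha1_gt1 alpha_gt0.
have aE := X2_alphaE alpha_gt0.
have d11 : d 1%N 1%N = 0.
  have := rec1 1%N 1%N; rewrite d21 d12 add0r => /esym/eqP.
  by rewrite mulf_eq0 gt_eqF/= ?mulr_gt0//; [move=> /eqP|lra].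
have d01 : d 0%N 1%N = 0.
  have := rec2 1%N 1%N erefl; rewrite /= d22 d21 d11 !mulr0 !add0r => /esym/eqP.
  have K0 : (2 * 1%:R - 4) * (alpha + 1) * (c + 1) != 0.
    rewrite (_ : 2 * 1%:R - 4 = - 2); last by ring.
    by rewrite !mulf_neq0 ?oppr_eq0 ?pnatr_eq0// gt_eqF// addr_gt0// (lt_trans ltr01).
  by rewrite mulf_eq0 (negbTE K0) => /eqP.
have d00 : d 0%N 0%N = 0.
  have := rec2 1%N 0%N erefl; have := rec1 0%N 0%N; have := rec1 1%N 0%N.
  rewrite /= d21 d11 d01 !add0r => -> ->.
  move: aE c1; move: c => c' -> c1 /esym/eqP K.
  have {}K : 2 * c' ^+ 2 * (c' - 1) * d 0%N 0%N == 0.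
    by rewrite -(eqP K); apply/eqP; ring.
  have L0 : 2 * c' ^+ 2 * (c' - 1) != 0.
    by rewrite gt_eqF// !mulr_gt0 ?exprn_gt0 ?subr_gt0// (lt_trans ltr01).
  by move: K; rewrite mulf_eq0 (negbTE L0) => /eqP.
have d10 : d 1%N 0%N = 0 by rewrite rec1 d01 d00 mulr0 addr0.
have d20 : d 2%N 0%N = 0 by rewrite rec1 d11 d10 mulr0 addr0.
have col n : [/\ d n 0%N = 0, d n.+1 0%N = 0 & d n.+2 0%N = 0].
  elim: n => [//|n [e0 e1 e2]]; split => //.
  have := rec1 n.+2 0%N; rewrite e2 mulr0 addr0 => ->.
  by rewrite rec2//= e0 e1 e2 !mulr0 !addr0.
move=> i j; elim: j i => [|j IH] i; first by have [] := col i.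
by have := rec1 i j; rewrite !IH mulr0 addr0 => /esym.
Qed.

Lemma moment_recursion_unique (mu nu : nat -> nat -> R) :
  moment_recursion1 alpha mu -> moment_recursion2 alpha mu ->
  moment_initial alpha mu ->
  moment_recursion1 alpha nu -> moment_recursion2 alpha nu ->
  moment_initial alpha nu ->
  forall i j, mu i j = nu i j.
Proof.
move=> m1 m2 [m22 m12 m21] n1 n2 [n22 n12 n21] i j; apply/eqP; rewrite -subr_eq0.
apply/eqP; apply: (@moment_recursion_zero (fun i j => mu i j - nu i j)).
- by move=> {}i {}j; rewrite m1 n1; ring.
- by move=> {}i {}j i0; rewrite m2// n2//; ring.
- by rewrite m22 n22 subrr.
- by rewrite m12 n12 subrr.
- by rewrite m21 n21 subrr.
Qed.

End Uniqueness.

Theorem theorem6p1 (R : realType) (alpha : R) (alpha_gt0 : 0 < alpha) :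
  (forall i j : nat,
     (@lebesgue_measure R).-integrable `]0, +oo[
       (EFin \o moment_integrand alpha i j)) /\
  [/\ moment_recursion1 alpha (adjusted_moment alpha),
      moment_recursion2 alpha (adjusted_moment alpha),
      moment_initial alpha (adjusted_moment alpha)
    & forall mu : nat -> nat -> R,
        moment_recursion1 alpha mu ->
        moment_recursion2 alpha mu ->
        moment_initial alpha mu ->
        forall i j : nat, mu i j = adjusted_moment alpha i j].
Proof.
have rec1 := adjusted_moment_recursion1 alpha_gt0.
have rec2 := adjusted_moment_recursion2 alpha_gt0.
have init := adjusted_moment_initial alpha_gt0.
split; first exact: moment_integrable.
split=> // mu mu1 mu2 mu0.
exact: (@moment_recursion_unique _ _ alpha_gt0).
Qed.
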